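(* Let $n\ge 2$ and $k$ be integers with $2\le k\le n$, and let $G$ be any simple graph on $n$ vertices with complement $\overline{G}$. Then (1) $1\leq \lambda_k(G)+\lambda_k(\overline{G})\leq n-\lceil k/2\rceil$; (2) $0\leq \lambda_k(G)\cdot \lambda_k(\overline{G})\leq \left[\frac{n-\lceil k/2\rceil}{2}\right]^2$. Moreover, these upper and lower bounds are sharp.
   Context: All graphs are finite, simple and undirected. For a graph $G$ and a vertex set $S\subseteq V(G)$ with $|S|\ge 2$, an $S$-Steiner tree is a subgraph of $G$ which is a tree and contains every vertex of $S$. $\lambda(S)$ denotes the maximum number of pairwise edge-disjoint $S$-Steiner trees in $G$. For an integer $k$ with $2\le k\le |V(G)|$, the generalized $k$-edge-connectivity is $\lambda_k(G)=\min\{\lambda(S): S\subseteq V(G),\ |S|=k\}$, with the convention $\lambda_k(G)=0$ if $G$ is disconnected. $\overline{G}$ is the complement of $G$. *)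

(* Defs.v *)
From mathcomp Require Import all_boot all_order all_algebra.
Set Implicit Arguments.
Unset Strict Implicit.
Unset Printing Implicit Defensive.

Record sgraph (T : finType) := SGraph {
  adj :> rel T;
  adj_sym : symmetric adj;
  adj_irrefl : irreflexive adj }.

Section Compl.
Variables (T : finType) (G : sgraph T).

Definition compl_adj : rel T := [rel x y | (x != y) && ~~ G x y].

Lemma compl_adj_sym : symmetric compl_adj.
Proof. by move=> x y; rewrite /compl_adj /= eq_sym adj_sym. Qed.

Lemma compl_adj_irrefl : irreflexive compl_adj.
Proof. by move=> x; rewrite /compl_adj /= eqxx. Qed.

Definition sg_compl : sgraph T := SGraph compl_adj_sym compl_adj_irrefl.

End Compl.

Section SteinerTrees.
Variable T : finType.

Definition edges (G : sgraph T) : {set {set T}} :=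
  [set [set p.1; p.2] | p : T * T & G p.1 p.2].

Definition connected_graph (G : sgraph T) : bool :=
  [forall x, forall y, connect G x y].

(* A pair (V, E) of a vertex set and a set of edges; [subgraph] below says
   when such a pair is a subgraph of G. *)
Definition pregraph : Type := ({set T} * {set {set T}})%type.

Definition subgraph (G : sgraph T) (H : pregraph) : bool :=
  (H.2 \subset edges G) && [forall e in H.2, e \subset H.1].

Definition edge_rel (E : {set {set T}}) : rel T :=
  [rel x y | [set x; y] \in E].

(* Cycles have pairwise distinct vertices, so their length is at most #|T|;
   bounding m accordingly loses nothing and keeps the predicate boolean. *)
Definition acyclic (E : {set {set T}}) : bool :=
  [forall m : 'I_#|T|.+1, forall c : m.-tuple T,
     (2 < m) ==> ~~ ucycleb (edge_rel E) c].

(* For the pairs satisfying [subgraph], every edge lies inside H.1, so that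
   a path of edges starting in H.1 stays in H.1. *)
Definition is_tree (H : pregraph) : bool :=
  [&& H.1 != set0,
      [forall x in H.1, forall y in H.1, connect (edge_rel H.2) x y]
    & acyclic H.2].

Definition steiner_tree (G : sgraph T) (S : {set T}) (H : pregraph) : bool :=
  [&& subgraph G H, is_tree H & S \subset H.1].

(* For 2 <= #|S| every S-Steiner tree has an edge, so edge-disjoint trees are
   distinct and may be collected in a set. *)
Definition steiner_packing (G : sgraph T) (S : {set T})
    (F : {set pregraph}) : bool :=
  [forall H in F, steiner_tree G S H]
  && [forall H1 in F, forall H2 in F,
        (H1 != H2) ==> [disjoint H1.2 & H2.2]].

Definition steiner_lambda (G : sgraph T) (S : {set T}) : nat :=
  \max_(F : {set pregraph} | steiner_packing G S F) #|F|.

(* For k <= #|T| the range of S is not empty, and the seed of the iterated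
   minimum, being the maximum over the same range, does not affect it. *)
Definition gen_edge_conn (k : nat) (G : sgraph T) : nat :=
  if connected_graph G then
    \big[minn / \max_(S : {set T} | #|S| == k) steiner_lambda G S]_
      (S : {set T} | #|S| == k) steiner_lambda G S
  else 0.

End SteinerTrees.

(* Main.v *)
(* Edge-disjoint Steiner trees of a graph and of its complement together form a
   packing of the complete graph, so the upper bound comes from counting the
   edges of K_n that meet S.  In K_n it is attained: the stars centred outside S
   and |S|/2 edge-disjoint double stars spanning S form a packing.  When n = k is
   a multiple of 4, half of the double stars and the other half give a graph and
   a complement with equal connectivities, which makes the product bound sharp. *)

Require Import Defs.
From mathcomp Require Import all_boot all_order all_algebra.
From mathcomp Require Import zify.
Import Order.TTheory GRing.Theory Num.Theory.
Set Implicit Arguments.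
Unset Strict Implicit.
Unset Printing Implicit Defensive.

(** Here [a] counts the trees with vertex set [S], [b] the others, and [sa], [sb] their edges
    meeting [S]. The bound on [sa] gives [2a <= k]; adding [a] to both sides of
    [a(k-1) + bk <= C(k,2) + k(n-k)] then yields [2(a+b) <= k + 2(n-k)]. *)
Lemma packing_arith a b k n sa sb :
    1 < k -> k <= n -> a * k.-1 <= sa -> b * k <= sb ->
    sa <= 'C(k, 2) -> sa + sb <= 'C(n, 2) - 'C(n - k, 2) ->
  a + b <= n - uphalf k.
Proof.
move=> k_gt1 /subnKC; move: (n - k) => l <-{n} le_a le_b le_sa le_sb.
have bin2E m : 'C(m, 2) * 2 = m * m.-1.
  by rewrite bin2 muln2 even_halfK // oddM; case: m => //= m; rewrite andNb.
have ll : l * l.-1 + l = l * l by case: (l) => //= m; rewrite mulnS addnC.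
move: (bin2E l) (bin2E k) (bin2E (k + l)) le_sa le_sb.
move: ('C(l, 2)) ('C(k, 2)) ('C(k + l, 2)) => cl ck cn.
case: k => [|k] in k_gt1 le_a le_b *; first by [].
rewrite addSn /= in le_a *; move=> ecl eck ecn le_sa le_sb.
have a2 : a * 2 <= k.+1 by rewrite -(@leq_pmul2r k) // -eck; lia.
have : k.+1 * ((a + b) * 2) <= k.+1 * (k.+1 + l * 2) by lia.
rewrite leq_pmul2l //; lia.
Qed.

(** * Edges, breadth-first search and trees *)

Section Trees.
Variable T : finType.
Implicit Types (x y r : T) (V S : {set T}) (E : {set {set T}}).
Implicit Types (G : sgraph T) (H : pregraph T).

Lemma edge_rel_sym E : symmetric (edge_rel E).
Proof. by move=> x y; rewrite /edge_rel /= setUC. Qed.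

Lemma mem_edges G x y : ([set x; y] \in edges G) = G x y.
Proof.
apply/imsetP/idP => [[[a b] /= Gab /setP eq_xy]|Gxy]; last by exists (x, y); rewrite ?inE.
have := eq_xy x; have := eq_xy y; have := eq_xy a; have := eq_xy b.
rewrite inE in Gab; have nab : a != b.
  by apply: contraTneq Gab => ->; rewrite adj_irrefl.
rewrite !inE !eqxx !orbT /= => /orP[]/eqP eb /orP[]/eqP ea; subst a b => //.
- by rewrite eqxx in nab.
- by rewrite adj_sym.
- by rewrite eqxx in nab.
Qed.

Lemma card_edge G e : e \in edges G -> #|e| = 2.
Proof.
case/imsetP=> -[a b]; rewrite inE /= => Gab ->; rewrite cards2.
by case: eqP Gab => // ->; rewrite adj_irrefl.
Qed.

(** For a reached [x] other than [r], [d x] is the length of a shortest path from [r] and [p x] the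
    last vertex but one of such a path. *)
Lemma bfs (e : rel T) r : exists (d : T -> nat) (p : T -> T),
  forall x, connect e r x -> x != r ->
    [/\ e (p x) x, connect e r (p x) & d (p x) < d x].
Proof.
pose P x n := [exists c : n.-tuple T, path e r c && (last r c == x)].
have PP x c : path e r c -> last r c = x -> P x (size c).
  by move=> ec <-; apply/existsP; exists (in_tuple c); rewrite ec eqxx.
have [d dP] : exists d : T -> nat, forall x, connect e r x ->
    P x (d x) /\ forall m, P x m -> d x <= m.
  apply: (@fin_all_exists _ (fun=> nat) (fun x n => connect e r x ->
    P x n /\ forall m, P x m -> n <= m)) => x.
  have [|_] := boolP (connect e r x); last by exists 0.
  case/connectP=> c ec xc; have exP : exists n, P x n.
    by exists (size c); apply: PP.
  by exists (ex_minn exP) => _; case: ex_minnP.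
exists d; apply: (@fin_all_exists _ (fun=> T) (fun x y => connect e r x ->
  x != r -> [/\ e y x, connect e r y & d y < d x])) => x.
have [rx|_] := boolP (connect e r x); last by exists x.
have [/existsP[[c /= /eqP sz] /andP[ec /eqP lx]] _] := dP _ rx.
elim/last_ind: c sz ec lx => [_ _ <-|c y _ sz]; first by exists r; rewrite eqxx.
rewrite rcons_path last_rcons => /andP[ec ey] eyx; subst y.
exists (last r c) => _ _; have rl : connect e r (last r c) by apply/connectP; exists c.
split=> //; have [_ /(_ _ (PP _ _ ec erefl)) le_d] := dP _ rl.
by rewrite -sz size_rcons ltnS.
Qed.

Definition parent_edges (p : T -> T) V r := [set [set x; p x] | x in V :\ r].

(** In an edge [{z, p z}] the child [z] has the larger [d], so the end [x] with [d y <= d x] is the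
    child. *)
Lemma parent_edgeP (p : T -> T) (d : T -> nat) V r x y :
    {in V :\ r, forall z, d (p z) < d z} ->
    [set x; y] \in parent_edges p V r -> d y <= d x -> y = p x.
Proof.
move=> dp /imsetP[z zV /setP eq_xy] le_yx; have := dp z zV.
have := eq_xy x; have := eq_xy y; have := eq_xy z; have := eq_xy (p z).
rewrite !inE !eqxx !orbT /=.
move=> /orP[]/eqP ep /orP[]/eqP ez _ _.
- by rewrite ep ez ltnn.
- by rewrite ep ez ltnNge le_yx.
- by rewrite -ez ep.
- by rewrite ep ez ltnn.
Qed.

(** Following parents lowers [d] and so ends at [r]. On a cycle, a vertex of maximal [d] would have
    its parent as both neighbours, yet these are distinct when the length exceeds 2. *)
Lemma parent_edges_tree (p : T -> T) (d : T -> nat) V r :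
    r \in V -> {in V :\ r, forall z, p z \in V /\ d (p z) < d z} ->
  is_tree (V, parent_edges p V r).
Proof.
move=> rV pV; have dp : {in V :\ r, forall z, d (p z) < d z}.
  by move=> z /pV[].
apply/and3P; split=> /=; first by apply/set0Pn; exists r.
  have to_r x : x \in V -> connect (edge_rel (parent_edges p V r)) x r.
    have [n] := ubnP (d x); elim: n => // n IHn in x * => ltn xV.
    have [->|nxr] := eqVneq x r; first exact: connect0.
    have xVr : x \in V :\ r by rewrite !inE nxr.
    have [pxV dpx] := pV _ xVr; apply: connect_trans (IHn _ _ pxV).
      by apply: connect1; apply/imsetP; exists x.
    by rewrite (leq_trans dpx).
  apply/forall_inP=> x xV; apply/forall_inP=> y yV.
  apply: connect_trans (to_r x xV) _.
  by rewrite (sym_connect_sym (@edge_rel_sym _)) to_r.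
apply/forallP=> m; apply/forallP=> c; apply/implyP=> m_gt2.
apply/negP=> /andP[cyc_c uniq_c]; have sz_c := size_tuple c.
have [x0 x0c] : exists x, x \in tval c.
  by case: (tval c) sz_c => [|x s] sz; [rewrite -sz in m_gt2 | exists x; rewrite inE eqxx].
case: (@arg_maxnP _ x0 (mem c) d x0c) => x xc max_x.
have [i c' def_c] := rot_to xc.
have sub_c z : z \in x :: c' -> d z <= d x.
  by rewrite -def_c mem_rot => zc; apply: max_x.
move: cyc_c uniq_c sz_c; rewrite -(rot_cycle i) -(rot_uniq i) -(size_rot i) def_c.
case: c' sub_c {def_c} => [|y [|z c']] sub_c /=; try by move=> _ _ sz; rewrite -sz in m_gt2.
rewrite rcons_path => /andP[exy /and3P[_ _ elx]] /and3P[_ /negP nyc _] _.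
have /= yp := parent_edgeP dp exy (sub_c y _).
have lc : last z c' \in z :: c' by apply: mem_last.
move: elx; rewrite edge_rel_sym => /= /(parent_edgeP dp) => lp.
apply: nyc; rewrite yp ?inE ?eqxx ?orbT // -lp //.
by apply: sub_c; rewrite 2!inE lc !orbT.
Qed.

Lemma spanning_tree V E r :
    r \in V -> {in E, forall e : {set T}, e \subset V} ->
    {in V, forall x, connect (edge_rel E) r x} ->
  exists2 E' : {set {set T}}, E' \subset E & is_tree (V, E').
Proof.
move=> rV EV conV; have [d [p dp]] := bfs (edge_rel E) r.
exists (parent_edges p V r).
  apply/subsetP=> _ /imsetP[x /setD1P[xr xV] ->].
  by have [] := dp _ (conV _ xV) xr; rewrite edge_rel_sym.
apply: (parent_edges_tree rV (d := d)) => x /setD1P[xr xV].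
have [e_px _ ltd] := dp _ (conV _ xV) xr; split=> //.
by apply: (subsetP (EV _ e_px)); rewrite !inE eqxx.
Qed.

(* Sending each vertex to the edge towards its parent in a breadth-first search
   from [r] is injective. *)
Lemma card_incident_edges E S r :
    {in S, forall x, connect (edge_rel E) r x} ->
  #|S :\ r| <= #|[set e in E | e :&: S != set0]|.
Proof.
move=> conS; have [d [p dp]] := bfs (edge_rel E) r.
have dS : {in S :\ r, forall z, d (p z) < d z}.
  by move=> x /setD1P[xr xS]; have [] := dp _ (conS _ xS) xr.
have inj_p : {in S :\ r &, injective (fun x => [set x; p x])}.
  move=> x y xS yS /= eq_xy; case: (eqVneq x y) => // nxy.
  have /setP/(_ x) := eq_xy; have /setP/(_ y) := eq_xy.
  rewrite !inE !eqxx (eq_sym y) (negPf nxy) /=.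
  move=> /eqP ypx /esym/eqP xpy.
  (* Distinct [x] and [y] sharing an edge are each other's parent, so [d] would decrease both
     ways. *)
  by have := dS x xS; have := dS y yS; rewrite -ypx -xpy; lia.
rewrite -(card_in_imset inj_p); apply/subset_leq_card/subsetP.
move=> _ /imsetP[x /setD1P[xr xS] ->]; have [] := dp _ (conS _ xS) xr.
rewrite edge_rel_sym => e_x _ _; rewrite inE; apply/andP; split=> //.
by apply/set0Pn; exists x; rewrite !inE eqxx.
Qed.

(** * Steiner trees and packings *)

Lemma tree_connect H x y : is_tree H -> x \in H.1 -> y \in H.1 ->
  connect (edge_rel H.2) x y.
Proof. by case/and3P=> _ /forall_inP conH _ xH; apply/forall_inP/conH. Qed.

(** A path in the tree from [x] to another vertex of [S] starts with such an edge. This is what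
    makes edge-disjoint Steiner trees distinct. *)
Lemma steiner_tree_edge G S H x : 1 < #|S| -> x \in S ->
  steiner_tree G S H -> exists2 y, [set x; y] \in H.2 & G x y.
Proof.
rewrite (cardsD1 x) => + xS; rewrite xS ltnS => /card_gt0P[z /setD1P[zx zS]].
case/and3P=> /andP[/subsetP HG _] treeH /subsetP SH.
have /connectP[[|y c] /=] := tree_connect treeH (SH _ xS) (SH _ zS).
  by move=> _ zx'; rewrite zx' eqxx in zx.
by case/andP=> xy _ _; exists y; rewrite // -mem_edges HG.
Qed.

Lemma steiner_lambda_max G S :
  exists2 F, steiner_packing G S F & steiner_lambda G S = #|F|.
Proof.
(* The empty packing makes the range of the maximum non-empty, so the maximum is attained. *)
have P0 : steiner_packing G S set0.
  by apply/andP; split; apply/forall_inP=> H; rewrite inE.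
have [|F FP eqF] := eq_bigmax_cond (A := steiner_packing G S)
  (fun F : {set pregraph T} => #|F|); first by apply/card_gt0P; exists set0.
by exists F.
Qed.

Lemma steiner_packingP G S (F : {set pregraph T}) : reflect
  ({in F, forall H, steiner_tree G S H} /\
   {in F &, forall H1 H2, H1 != H2 -> [disjoint H1.2 & H2.2]})
  (steiner_packing G S F).
Proof.
apply: (iffP andP) => -[treeF disF]; split.
- exact/forall_inP.
- by move=> H1 H2 F1 F2; apply/implyP; move/forall_inP/(_ _ F1)/forall_inP/(_ _ F2): disF.
- exact/forall_inP.
- by apply/forall_inP=> H1 F1; apply/forall_inP=> H2 F2; apply/implyP/disF.
Qed.

(** * Upper bound by counting the edges that meet [S] *)

Lemma leq_sum_card_disjoint (I J : finType) (F : {set I}) (f : I -> {set J})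
    (B : {set J}) :
    {in F, forall i, f i \subset B} ->
    {in F &, forall i j, i != j -> [disjoint f i & f j]} ->
  \sum_(i in F) #|f i| <= #|B|.
Proof.
move=> fB dis_f.
(* Extending [f] by the empty set outside [F] gives disjointness over all indices, as
   [partition_disjoint_bigcup] asks. *)
pose g (i : I) := if i \in F then f i else set0.
have -> : \sum_(i in F) #|f i| = #|\bigcup_i g i|.
  rewrite -sum1_card partition_disjoint_bigcup /= => [|i j nij].
    rewrite [RHS](bigID (mem F)) /= [X in _ + X]big1 ?addn0.
      by apply: eq_bigr => i iF; rewrite sum1_card /g iF.
    by move=> i /negPf iF; rewrite sum1_card /g iF cards0.
  rewrite /g; case: ifP => iF; last by rewrite -setI_eq0 set0I.
  by case: ifP => jF; [apply: dis_f | rewrite -setI_eq0 setI0].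
apply/subset_leq_card/bigcupsP=> i _; rewrite /g.
by case: ifP => [/fB | _] //; rewrite sub0set.
Qed.

(* Trees with vertex set S have #|S| - 1 edges inside S, all others have at
   least #|S| edges meeting S. *)
Lemma steiner_lambda_ub G S : 1 < #|S| ->
  steiner_lambda G S <= #|T| - uphalf #|S|.
Proof.
move=> S_gt1; have [F /steiner_packingP[treeF disF] ->] := steiner_lambda_max G S.
have [s sS] : exists s, s \in S by apply/card_gt0P; apply: ltnW.
have card2 H e : H \in F -> e \in H.2 -> #|e| = 2.
  move=> /treeF/and3P[/andP[/subsetP HG _] _ _] eH.
  exact: card_edge (HG _ eH).
pose inc (H : pregraph T) := [set e in H.2 | e :&: S != set0].
pose A := [set H in F | H.1 == S]; pose B := F :\: A.
(* These are the edges of the complete graphs on [S], on [T] and on the complement of [S];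
   [ET :\: EC] collects the pairs that meet [S]. *)
pose ES := [set e : {set T} | e \subset S & #|e| == 2].
pose ET := [set e : {set T} | e \subset setT & #|e| == 2].
pose EC := [set e : {set T} | e \subset ~: S & #|e| == 2].
have incdis : {in F &, forall H1 H2, H1 != H2 -> [disjoint inc H1 & inc H2]}.
  move=> H1 H2 F1 F2 neqH; apply: disjointWl (disjointWr _ (disF _ _ F1 F2 neqH));
    by apply/subsetP=> e; rewrite inE => /andP[].
have AF : {subset A <= F} by move=> H; rewrite inE => /andP[].
have BF : {subset B <= F} by move=> H; rewrite inE => /andP[].
have leA H : H \in F -> #|S|.-1 <= #|inc H|.
  move=> /treeF/and3P[_ treeH /subsetP SH].
  have := @card_incident_edges H.2 S s; rewrite (cardsD1 s S) sS; apply.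
  by move=> x xS; apply: tree_connect => //; apply: SH.
have leB H : H \in B -> #|S| <= #|inc H|.
  rewrite inE => /andP[+ HF]; rewrite inE HF /= => neqH.
  have /and3P[_ treeH SH] := treeF _ HF.
  (* With a root [r] outside [S], [S :\ r] is all of [S]: one edge more than in [leA]. *)
  have /properP[_ [r rH rS]] : S \proper H.1 by rewrite properEneq eq_sym neqH.
  have := @card_incident_edges H.2 S r; rewrite (cardsD1 r S) (negPf rS); apply.
  by move=> x xS; apply: tree_connect => //; apply: (subsetP SH).
have sumA : \sum_(H in A) #|inc H| <= #|ES|.
  apply: leq_sum_card_disjoint => [H|H1 H2 /AF ? /AF ?]; last exact: incdis.
  rewrite inE => /andP[HF /eqP HS]; apply/subsetP=> e; rewrite !inE => /andP[eH _].
  rewrite (card2 _ _ HF eH) eqxx andbT -HS.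
  by have /and3P[/andP[_ /forall_inP/(_ _ eH)]] := treeF _ HF.
have sumF : \sum_(H in F) #|inc H| <= #|ET :\: EC|.
  apply: leq_sum_card_disjoint => // H HF; apply/subsetP=> e.
  rewrite !inE subsetT => /andP[eH eS]; rewrite (card2 _ _ HF eH) eqxx !andbT.
  by rewrite -disjoints_subset -setI_eq0.
have cA : #|A| * #|S|.-1 <= \sum_(H in A) #|inc H|.
  by rewrite -sum_nat_const; apply: leq_sum => H /AF/leA.
have cB : #|B| * #|S| <= \sum_(H in B) #|inc H|.
  by rewrite -sum_nat_const; apply: leq_sum => H /leB.
have eqF : \sum_(H in F) #|inc H| =
    \sum_(H in A) #|inc H| + \sum_(H in B) #|inc H|.
  rewrite (big_setID A) /=; congr (_ + _); apply: eq_bigl => H.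
  by rewrite !inE; case: (H \in F).
have cF : #|F| = #|A| + #|B|.
  rewrite -(cardsID A F); congr (_ + _); apply: eq_card => H.
  by rewrite !inE; case: (H \in F).
have EC_ET : EC \subset ET.
  by apply/subsetP=> e; rewrite !inE subsetT => /andP[].
have cardEC : #|EC| = 'C(#|T| - #|S|, 2) by rewrite cards_draws cardsCs setCK.
rewrite cardsD (setIidPr EC_ET) cardEC eqF cards_draws cardsT in sumF.
rewrite cards_draws in sumA; rewrite cF.
exact: packing_arith S_gt1 (max_card _) cA cB sumA sumF.
Qed.

(** * Lower bounds from colourings, and passage to [gen_edge_conn] *)

(** The symmetric [c] colours unordered pairs, so distinct colour classes are edge-disjoint. Each
    class [f i] connects [V i] and hence contains a spanning tree of [V i]; these trees form the
    packing. *)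
Lemma steiner_lambda_lb (I : finType) (C : eqType) (f : I -> C) (c : T -> T -> C)
    (V : I -> {set T}) (r : I -> T) G S :
    1 < #|S| -> injective f -> (forall x y, c x y = c y x) ->
    (forall i, S \subset V i) -> (forall i, r i \in V i) ->
    (forall i, {in V i, forall x, connect
      [rel x y | [&& x \in V i, y \in V i, G x y & c x y == f i]] (r i) x}) ->
  #|I| <= steiner_lambda G S.
Proof.
move=> S_gt1 inj_f c_sym SV rV conV.
pose E i := [set [set p.1; p.2] |
  p : T * T & [&& p.1 \in V i, p.2 \in V i, G p.1 p.2 & c p.1 p.2 == f i]].
have EP i e : e \in E i -> exists x y,
    [/\ e = [set x; y], x \in V i, y \in V i, G x y & c x y = f i].
  by case/imsetP=> -[x y]; rewrite inE /= => /and4P[xV yV Gxy /eqP cxy] ->; exists x, y.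
have E_V i : {in E i, forall e : {set T}, e \subset V i}.
  by move=> _ /EP[x [y [-> xV yV _ _]]]; rewrite subUset !sub1set xV.
have con_E i : {in V i, forall x, connect (edge_rel (E i)) (r i) x}.
  move=> x /conV; apply: connect_sub => {}x y /= xy; apply: connect1.
  by apply/imsetP; exists (x, y); rewrite ?inE.
have [t tP] : exists t : I -> {set {set T}},
    forall i, t i \subset E i /\ is_tree (V i, t i).
  apply: (@fin_all_exists _ (fun=> {set {set T}}) (fun i t =>
    t \subset E i /\ is_tree (V i, t))) => i.
  by have [t tE treet] := spanning_tree (rV i) (@E_V i) (@con_E i); exists t.
have tV i : steiner_tree G S (V i, t i).
  have [/subsetP tE treet] := tP i.
  apply/and3P; split=> //=; apply/andP; split=> /=.
    by apply/subsetP=> e /tE/EP[x [y [-> _ _ Gxy _]]]; rewrite mem_edges.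
  by apply/forall_inP=> e /tE/E_V.
have t_eq i j e : e \in t i -> e \in t j -> i = j.
  move=> /(subsetP (tP i).1)/EP[x [y [-> _ _ _ ci]]].
  move=> /(subsetP (tP j).1)/EP[x' [y' [eq_xy _ _ /[swap] cj Gxy]]].
  apply: inj_f; rewrite -ci -cj.
  have nxy : x' != y' by apply: contraTneq Gxy => ->; rewrite adj_irrefl.
  move/setP: eq_xy => eq_xy; have := eq_xy x'; have := eq_xy y'.
  rewrite !inE !eqxx ?orbT /= => /orP[]/eqP ey /orP[]/eqP ex;
    rewrite ex ey ?eqxx // in nxy *.
have inj_t : injective (fun i => (V i, t i)).
  move=> i j [_ eqt]; have [x xS] : exists x, x \in S by apply/card_gt0P; lia.
  have [y e_t _] := steiner_tree_edge S_gt1 xS (tV i).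
  by apply: (t_eq _ _ [set x; y]); rewrite -?eqt.
rewrite -cardsT -(card_imset _ inj_t).
apply: (leq_bigmax_cond (F := fun F : {set pregraph T} => #|F|)).
apply/steiner_packingP; split=> [_ /imsetP[i _ ->] // |].
move=> _ _ /imsetP[i _ ->] /imsetP[j _ ->] neq.
rewrite -setI_eq0; apply: contraNT neq => /set0Pn[e /setIP[/= ei ej]].
by rewrite (t_eq _ _ _ ei ej).
Qed.

Lemma gen_edge_conn_le k G S : #|S| = k ->
  gen_edge_conn k G <= steiner_lambda G S.
Proof.
move=> Sk; rewrite /gen_edge_conn; case: ifP => // _.
by rewrite -minEnat -leEnat; apply: bigmin_le_cond; rewrite Sk.
Qed.

Lemma exists_card_set k : k <= #|T| -> exists S : {set T}, #|S| = k.
Proof.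
move=> le_k; have : 0 < #|[set A : {set T} | A \subset setT & #|A| == k]|.
  by rewrite cards_draws cardsT bin_gt0.
by case/card_gt0P=> S; rewrite inE => /andP[_ /eqP]; exists S.
Qed.

Lemma gen_edge_conn_ge k m G : k <= #|T| -> connected_graph G ->
  (forall S, #|S| = k -> m <= steiner_lambda G S) -> m <= gen_edge_conn k G.
Proof.
move=> le_k conG le_m; rewrite /gen_edge_conn conG -minEnat -leEnat.
apply/bigmin_geP; split=> [|S /eqP/le_m] //.
(* The seed of the iterated minimum must be bounded too: it is at least the value at any set of size
   [k]. *)
have [S Sk] := exists_card_set le_k; apply: leq_trans (le_m S Sk) _.
by apply: (leq_bigmax_cond (F := steiner_lambda G)); rewrite Sk.
Qed.

(** * The complete graph and the upper bound for the sum *)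

Lemma complete_sym : symmetric [rel x y : T | x != y].
Proof. by move=> x y; rewrite /= eq_sym. Qed.

Lemma complete_irrefl : irreflexive [rel x y : T | x != y].
Proof. by move=> x; rewrite /= eqxx. Qed.

Definition complete := SGraph complete_sym complete_irrefl.

Lemma steiner_lambda_compl G S : 1 < #|S| ->
  steiner_lambda G S + steiner_lambda (sg_compl G) S <= steiner_lambda complete S.
Proof.
move=> S_gt1.
have [F1 /steiner_packingP[t1 d1] ->] := steiner_lambda_max G S.
have [F2 /steiner_packingP[t2 d2] ->] := steiner_lambda_max (sg_compl G) S.
have G_K (G' : sgraph T) H : steiner_tree G' S H -> steiner_tree complete S H.
  case/and3P=> /andP[HG HV] treeH SH; apply/and3P; split=> //.
  rewrite /subgraph HV andbT; apply: subset_trans HG _.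
  apply/subsetP=> e /[dup] eG /imsetP[[x y] /= _ eqe]; move: eG; rewrite eqe !mem_edges.
  by apply: contraTneq => ->; rewrite adj_irrefl.
have dis H1 H2 : steiner_tree G S H1 -> steiner_tree (sg_compl G) S H2 ->
    [disjoint H1.2 & H2.2].
  case/and3P=> /andP[/subsetP H1G _] _ _ /and3P[/andP[/subsetP H2G _] _ _].
  rewrite -setI_eq0; apply/set0Pn=> -[e /setIP[/H1G e1 /H2G e2]].
  have /imsetP[[x y] /= _ eqe] := e1; move: e1 e2; rewrite eqe !mem_edges => Gxy.
  by rewrite /= /compl_adj /= Gxy andbF.
have [x xS] : exists x, x \in S by apply/card_gt0P; lia.
(* The sizes add up because a common tree would have an edge at [x] lying in both graphs. *)
have dF : [disjoint F1 & F2].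
  rewrite -setI_eq0; apply/set0Pn=> -[H /setIP[/t1 H1 /t2 H2]].
  have [y xy _] := steiner_tree_edge S_gt1 xS H1.
  by have /pred0P/(_ [set x; y]) /= := dis _ _ H1 H2; rewrite xy.
have -> : #|F1| + #|F2| = #|F1 :|: F2|.
  by apply/esym/eqP; rewrite (leq_card_setU F1 F2).
apply: (leq_bigmax_cond (F := fun F : {set pregraph T} => #|F|)).
apply/steiner_packingP; split=> [H /setUP[/t1|/t2]|]; try exact: G_K.
move=> H1 H2 /setUP[] F1H /setUP[] F2H neqH.
- exact: d1.
- by apply: dis; [apply: t1 | apply: t2].
- by rewrite disjoint_sym; apply: dis; [apply: t1 | apply: t2].
- exact: d2.
Qed.

(** A single set [S] of size [k] bounds both minima at once. *)
Lemma gen_edge_conn_compl_ub k G : 1 < k <= #|T| ->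
  gen_edge_conn k G + gen_edge_conn k (sg_compl G) <= #|T| - uphalf k.
Proof.
case/andP=> k_gt1 /exists_card_set[S Sk]; rewrite -Sk in k_gt1 *.
apply: leq_trans (leq_add _ _) (leq_trans (steiner_lambda_compl G k_gt1) _).
- exact: gen_edge_conn_le.
- exact: gen_edge_conn_le.
- exact: steiner_lambda_ub.
Qed.

(** * Connectedness and positivity of the sum *)

(** Vertices in different components of [G] are adjacent in the complement; two vertices of one
    component have a common neighbour there, namely any [w] of another component. *)
Lemma connected_compl G : connected_graph G || connected_graph (sg_compl G).
Proof.
case: (boolP (connected_graph G)) => //= /forallPn[x /forallPn[y nxy]].
have symG : connect_sym G by apply: sym_connect_sym; apply: adj_sym.
have adjC u v : ~~ connect G u v -> sg_compl G u v.
  move=> nuv; rewrite /= /compl_adj /=; apply/andP; split.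
    by apply: contraNneq nuv => ->.
  by apply: contraNN nuv => /connect1.
apply/forallP=> u; apply/forallP=> v.
have [uv|/adjC] := boolP (connect G u v); last exact: connect1.
(* Since [x] and [y] lie in different components, one of them is not in that of [u]. *)
have [w uw] : exists w, ~~ connect G u w.
  have [ux|nux] := boolP (connect G u x); last by exists x.
  exists y; apply: contraNN nxy; apply: connect_trans.
  by rewrite symG.
apply: (@connect_trans _ _ w); apply: connect1; apply: adjC => //.
by apply: contraNN uw => /[1!symG]; apply: connect_trans.
Qed.

Lemma gen_edge_conn_gt0 k G : 1 < k <= #|T| -> connected_graph G ->
  0 < gen_edge_conn k G.
Proof.
case/andP=> k_gt1 le_k conG; apply: gen_edge_conn_ge => // S Sk.
have [r _] : exists r, r \in S by apply/card_gt0P; lia.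
(* A single colour, indexed by [unit], yields one spanning tree. *)
rewrite -card_unit.
apply: (@steiner_lambda_lb _ _ id (fun _ _ => tt) (fun=> setT) (fun=> r)) => //.
- by rewrite Sk.
move=> i x xT; have /forallP/(_ r)/forallP/(_ x) := conG.
by apply: connect_sub => u v uv; apply: connect1; rewrite /= !inE uv eq_sym; case: i.
Qed.

Lemma gen_edge_conn_compl_lb k G : 1 < k <= #|T| ->
  0 < gen_edge_conn k G + gen_edge_conn k (sg_compl G).
Proof.
move=> k_bd; rewrite addn_gt0.
by case/orP: (connected_compl G) => /(gen_edge_conn_gt0 k_bd) ->; rewrite ?orbT.
Qed.

Lemma gen_edge_conn_isolated k G x y : x != y -> (forall z, ~~ G x z) ->
  gen_edge_conn k G = 0.
Proof.
move=> nxy isox; rewrite /gen_edge_conn; case: ifP => // /forallP/(_ x)/forallP/(_ y).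
case/connectP=> -[|z p] /=; first by move=> _ yx; rewrite yx eqxx in nxy.
by rewrite (negPf (isox z)).
Qed.

(** * Double stars and optimal packings of the complete graph *)

(* Vertices 2i and 2i+1 form the i-th pair.  Colour i is a double star with
   centres 2i and 2i+1: of the four edges between two pairs, the two joining
   equal parities go to the smaller pair, the other two to the larger pair. *)
Definition pair_color (x y : nat) :=
  if odd x == odd y then minn x./2 y./2 else maxn x./2 y./2.

Lemma pair_color_sym (x y : nat) : pair_color x y = pair_color y x.
Proof. by rewrite /pair_color eq_sym minnC maxnC. Qed.

(** Vertices of [S] are numbered by their position in [enum S]; outside [S] the index defaults to
    [#|S|], so only colours of pairs inside [S] carry meaning. *)
Definition rank_color S x y := pair_color (index x (enum S)) (index y (enum S)).

Lemma rank_color_sym S x y : rank_color S x y = rank_color S y x.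
Proof. exact: pair_color_sym. Qed.

(** The bound on [i] ensures that both centres, at positions [2i] and [2i+1], exist. They are
    adjacent in colour [i], and every other vertex of [S] is joined to one of them. *)
Lemma connect_rank_color S i (e : rel T) : i < #|S|./2 ->
    {in S &, forall x y, x != y -> rank_color S x y = i -> e x y} ->
  exists2 r, r \in S & {in S, forall x, connect e r x}.
Proof.
move=> lt_i e_color.
have [s _] : exists s, s \in S by apply/card_gt0P; lia.
have szS : size (enum S) = #|S| by rewrite -cardE.
have nthS j : j < #|S| -> nth s (enum S) j \in S.
  by move=> lt_j; rewrite -mem_enum mem_nth ?szS.
have idx j : j < #|S| -> index (nth s (enum S) j) (enum S) = j.
  by move=> lt_j; rewrite index_uniq ?enum_uniq ?szS.
pose a := nth s (enum S) i.*2; pose b := nth s (enum S) i.*2.+1.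
have lta : i.*2 < #|S| by lia.
have ltb : i.*2.+1 < #|S| by lia.
have step c x : c < #|S| -> x \in S -> index x (enum S) != c ->
    pair_color c (index x (enum S)) = i -> e (nth s (enum S) c) x.
  move=> ltc xS nxc col; apply: e_color; rewrite ?nthS //.
    by apply: contraNneq nxc => <-; rewrite idx.
  by rewrite /rank_color idx.
have eab : e a b.
  apply: (step i.*2) => //; rewrite ?nthS ?idx /pair_color //; first by lia.
  by rewrite /= odd_double /= doubleK; lia.
exists a => [|x xS]; first exact: nthS.
have [xa|nxa] := eqVneq (index x (enum S)) i.*2.
  by rewrite /a -xa nth_index ?mem_enum.
have [xb|nxb] := eqVneq (index x (enum S)) i.*2.+1.
  by apply: connect1; rewrite -[x](nth_index s (s := enum S)) ?mem_enum ?xb.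
(* The edges from [x] to the two centres have as colours the minimum and the maximum of [i] and the
   pair number of [x]; one of these is [i]. *)
suff [xa|xb] : pair_color i.*2 (index x (enum S)) = i \/
               pair_color i.*2.+1 (index x (enum S)) = i.
- exact/connect1/step.
- by apply: connect_trans (connect1 eab) _; apply/connect1/step.
move: (index _ _) nxa nxb => j nja njb.
rewrite /pair_color /= odd_double /= doubleK uphalf_double.
by case: (boolP (odd j)) => oj /=; lia.
Qed.

Lemma steiner_lambda_complete S : 1 < #|S| ->
  #|T| - uphalf #|S| <= steiner_lambda complete S.
Proof.
move=> S_gt1.
have le_S : #|S| <= #|T| := max_card _.
pose I : finType := ('I_(#|S|./2) + {x | x \notin S})%type.
have -> : #|T| - uphalf #|S| = #|I|.
  have cS : #|{: {x | x \notin S}}| = #|T| - #|S|.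
    rewrite card_sig -[S in RHS]setCK -cardsCs.
    by apply: eq_card => x; rewrite !inE.
  rewrite card_sum card_ord cS; lia.
pose e (i : nat) := [rel x y |
  [&& x \in S, y \in S, x != y & rank_color S x y == i]].
have [r rP] : exists r : 'I_(#|S|./2) -> T, forall i,
    r i \in S /\ {in S, forall x, connect (e i) (r i) x}.
  apply: (@fin_all_exists _ (fun=> T) (fun (i : 'I_(#|S|./2)) r =>
    r \in S /\ {in S, forall x, connect (e i) r x})) => i.
  have [|r rS conr] := @connect_rank_color S i (e i) (ltn_ord i); last by exists r.
  by move=> x y xS yS nxy /= ->; rewrite xS yS nxy eqxx.
(* A pair with one end outside [S] is coloured by that end, the centre of its star. The value
   [inl 0] on pairs outside [S] is harmless, as each [V i] has at most one vertex outside [S]. *)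
pose c x y : nat + T := if x \in S then
    if y \in S then inl (rank_color S x y) else inr y
  else if y \in S then inr x else inl 0.
pose f (i : I) : nat + T :=
  match i with inl j => inl (val j) | inr x => inr (val x) end.
pose V (i : I) :=
  if i is inr x then val x |: S else S.
pose root (i : I) := match i with inl j => r j | inr x => val x end.
apply: (@steiner_lambda_lb I _ f c V root) => //.
- by case=> [i|x] [j|y] //= [] => [/val_inj|/val_inj] ->.
- move=> x y; rewrite /c rank_color_sym; case: (x \in S); case: (y \in S) => //.
- by case=> [i|x] //=; rewrite subsetU1.
- by case=> [i|x] /=; [have [] := rP i | rewrite setU11].
case=> [i|[v vS]] x /= => [xS|/setU1P[->|xS]].
- have [_ /(_ _ xS)] := rP i; apply: connect_sub => u w /= /and4P[uS wS nuw /eqP col].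
  by apply: connect1; rewrite /= /c uS wS nuw col eqxx.
- exact: connect0.
apply: connect1; rewrite /= /c !inE eqxx xS orbT (negPf vS) eqxx andbT /=.
by apply: contraNneq vS => ->.
Qed.

Lemma gen_edge_conn_complete k : 1 < k <= #|T| ->
  gen_edge_conn k complete + gen_edge_conn k (sg_compl complete) = #|T| - uphalf k.
Proof.
move=> k_bd; apply/eqP; rewrite eqn_leq gen_edge_conn_compl_ub //=.
(* The complete graph alone reaches the bound, so the term of the complement is dropped. *)
apply: leq_trans (leq_addr _ _); case/andP: k_bd => k_gt1 le_k.
apply: gen_edge_conn_ge => // [|S Sk].
  apply/forallP=> x; apply/forallP=> y.
  by case: (eqVneq x y) => [->|nxy]; [apply: connect0 | apply: connect1].
by rewrite -Sk; apply: steiner_lambda_complete; rewrite Sk.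
Qed.

(** * Stars: sum 1 and product 0 *)

Section Star.
Variable o : T.

Lemma star_sym : symmetric [rel x y : T | (x != y) && ((x == o) || (y == o))].
Proof. by move=> x y; rewrite /= eq_sym orbC. Qed.

Lemma star_irrefl :
  irreflexive [rel x y : T | (x != y) && ((x == o) || (y == o))].
Proof. by move=> x; rewrite /= eqxx. Qed.

Definition star := SGraph star_sym star_irrefl.

Lemma connected_star : connected_graph star.
Proof.
have con_o x : connect star o x.
  have [->|nxo] := eqVneq x o; first exact: connect0.
  by apply: connect1; rewrite /= eqxx eq_sym nxo.
apply/forallP=> x; apply/forallP=> y; apply: connect_trans (con_o y).
by rewrite (sym_connect_sym (@adj_sym _ star)).
Qed.

(** As [k > 1], [S] contains a leaf [v], whose only edge [{v, o}] lies in every Steiner tree; hence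
    no two trees are edge-disjoint. *)
Lemma gen_edge_conn_star k : 1 < k <= #|T| -> gen_edge_conn k star = 1.
Proof.
move=> k_bd; apply/eqP; rewrite eqn_leq gen_edge_conn_gt0 ?connected_star // andbT.
case/andP: k_bd => k_gt1 /exists_card_set[S Sk].
apply: leq_trans (gen_edge_conn_le _ Sk) _.
have [v /setD1P[vo vS]] : exists v, v \in S :\ o.
  by apply/card_gt0P; have := cardsD1 o S; rewrite Sk; lia.
have [F /steiner_packingP[treeF disF] ->] := steiner_lambda_max star S.
have vF H : H \in F -> [set v; o] \in H.2.
  move=> /treeF treeH; have [|y vy] := steiner_tree_edge _ vS treeH; first by rewrite Sk.
  by rewrite /= (negPf vo) => /andP[_ /eqP <-].
apply/card_le1_eqP=> H1 H2 F1 F2; apply/eqP/contraT=> neqH.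
have /pred0P/(_ [set v; o]) := disF _ _ F2 F1 neqH.
by rewrite /= !vF.
Qed.

Lemma gen_edge_conn_compl_star k : 1 < #|T| -> gen_edge_conn k (sg_compl star) = 0.
Proof.
rewrite -cardsT (cardsD1 o) inE ltnS => /card_gt0P[x /setD1P[nxo _]].
apply: (@gen_edge_conn_isolated _ _ o x); first by rewrite eq_sym.
by move=> z; rewrite /= /compl_adj /= eqxx orTb andbT; case: (o != z).
Qed.

End Star.

(** * Balanced graphs: equality in the product bound *)

Section Balanced.
Variable m : nat.
Hypothesis cardT4 : #|T| = m.+1 * 4.

Let color := rank_color [set: T].

Lemma balanced_sym : symmetric [rel x y | (x != y) && (color x y <= m)].
Proof. by move=> x y; rewrite /= eq_sym /color rank_color_sym. Qed.

Lemma balanced_irrefl : irreflexive [rel x y | (x != y) && (color x y <= m)].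
Proof. by move=> x; rewrite /= eqxx. Qed.

(** On [4(m+1)] vertices there are [2(m+1)] double stars, of colours [0] to [2m+1]; this graph is
    the union of the first half, and its complement that of the second. *)
Definition balanced := SGraph balanced_sym balanced_irrefl.

(** Each of the [m+1] colours from [j] on is a spanning double star in [G]. The offset [j] serves
    both halves: [0] for [balanced], [m.+1] for its complement. *)
Lemma gen_edge_conn_colors G j : j + m.+1 <= #|T|./2 ->
    (forall x y, x != y -> j <= color x y < j + m.+1 -> G x y) ->
  m.+1 <= gen_edge_conn #|T| G.
Proof.
move=> le_j G_color.
have rP (i : 'I_m.+1) : exists r, {in [set: T], forall x, connect
    [rel x y | G x y && (color x y == j + i)] r x}.
  have [||r _ conr] := @connect_rank_color [set: T] (j + i)
      [rel x y | G x y && (color x y == j + i)]; last by exists r.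
    by rewrite cardsT; have := ltn_ord i; lia.
  move=> x y _ _ nxy col; rewrite /= /color col eqxx andbT.
  by apply: G_color => //; rewrite /color col leq_addr ltn_add2l /=.
have {rP}[r rP] : exists r : 'I_m.+1 -> T, forall i : 'I_m.+1,
    {in [set: T], forall x, connect
    [rel x y | G x y && (color x y == j + i)] (r i) x}.
  exact: (@fin_all_exists _ (fun=> T) (fun (i : 'I_m.+1) r =>
    {in [set: T], forall x, connect [rel x y | G x y && (color x y == j + i)] r x})).
apply: gen_edge_conn_ge => // [|S ST].
  have con0 x : connect G (r ord0) x.
    by apply: connect_sub (rP ord0 x (in_setT x)) => u v /andP[/connect1].
  apply/forallP=> x; apply/forallP=> y; apply: connect_trans (con0 y).
  by rewrite (sym_connect_sym (@adj_sym _ G)).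
rewrite -[m.+1]card_ord.
apply: (@steiner_lambda_lb 'I_m.+1 _ (fun i : 'I_m.+1 => j + i) color (fun=> setT) r) => //.
- by rewrite ST; lia.
- by move=> i i' /addnI/val_inj.
- exact: rank_color_sym.
move=> i x xT; apply: connect_sub (rP i x xT) => u v /= uv.
by apply: connect1; rewrite /= !inE uv.
Qed.

Lemma gen_edge_conn_balanced :
  gen_edge_conn #|T| balanced = m.+1 /\
  gen_edge_conn #|T| (sg_compl balanced) = m.+1.
Proof.
have le1 : m.+1 <= gen_edge_conn #|T| balanced.
  apply: (@gen_edge_conn_colors _ 0); first by lia.
  by move=> x y nxy; rewrite /= nxy add0n.
have le2 : m.+1 <= gen_edge_conn #|T| (sg_compl balanced).
  apply: (@gen_edge_conn_colors _ m.+1); first by lia.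
  by move=> x y nxy; rewrite /= /compl_adj /= nxy -ltnNge /= => /andP[].
(* The sum is at most [4(m+1) - 2(m+1) = 2(m+1)], so both lower bounds are equalities. *)
have := @gen_edge_conn_compl_ub #|T| balanced; lia.
Qed.

End Balanced.
End Trees.

(** * Assembly of the bounds and the extremal graphs *)

Local Open Scope ring_scope.

Theorem theorem2 :
  (forall n k : nat, (2 <= n)%N -> (2 <= k <= n)%N ->
     (forall (T : finType) (G : sgraph T), #|T| = n ->
        (1 <= gen_edge_conn k G + gen_edge_conn k (sg_compl G)
           <= n - uphalf k)%N
        /\ 0 <= ((gen_edge_conn k G * gen_edge_conn k (sg_compl G))%N%:R : rat)
             <= ((n - uphalf k)%N%:R / 2%:R) ^+ 2)
     /\ (exists G : sgraph 'I_n,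
           (gen_edge_conn k G + gen_edge_conn k (sg_compl G) = 1)%N)
     /\ (exists G : sgraph 'I_n,
           (gen_edge_conn k G + gen_edge_conn k (sg_compl G)
            = n - uphalf k)%N)
     /\ (exists G : sgraph 'I_n,
           (gen_edge_conn k G * gen_edge_conn k (sg_compl G) = 0)%N))
  /\ (forall N : nat, exists n k : nat,
        [/\ (N <= k)%N, (2 <= n)%N, (2 <= k <= n)%N
          & exists G : sgraph 'I_n,
              (gen_edge_conn k G * gen_edge_conn k (sg_compl G))%N%:R
              = ((n - uphalf k)%N%:R / 2%:R) ^+ 2 :> rat]).
Proof.
split=> [n k n_ge2 k_bd|N]; last first.
  have cardI := card_ord (N.+1 * 4).
  (* With [n = k] a multiple of 4, [n - uphalf k = 2(N+1)], and its half is the common connectivity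
     [N+1]. *)
  exists (N.+1 * 4)%N, (N.+1 * 4)%N; split; try lia.
  exists (balanced _ N); have [] := gen_edge_conn_balanced cardI.
  rewrite cardI => -> ->.
  have -> : (N.+1 * 4 - uphalf (N.+1 * 4) = N.+1 * 2)%N by lia.
  by rewrite (natrM _ N.+1 2) mulfK // expr2 natrM.
have n_gt1 : (1 < #|'I_n|)%N by rewrite card_ord.
have k_bdI : (1 < k <= #|'I_n|)%N by rewrite card_ord.
split=> [T G cardT|].
  rewrite -cardT in k_bd *.
  have ub := gen_edge_conn_compl_ub G k_bd.
  rewrite gen_edge_conn_compl_lb // ub; split=> //.
  (* With the denominator cleared, the claim follows from [4ab <= (a+b)^2] and the bound on the
     sum. *)
  rewrite ler0n expr_div_n ler_pdivlMr // -!natrX -natrM ler_nat.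
  by rewrite mulnC; apply: leq_trans (nat_AGM2 _ _).1 _; rewrite leq_sqr.
pose o := Ordinal (ltnW n_ge2).
(* The values 1 and 0 for a star and its complement attain both lower bounds at once. *)
have starE := gen_edge_conn_star o k_bdI.
have star0 := gen_edge_conn_compl_star o k n_gt1.
split; first by exists (star o); rewrite starE star0.
split; last by exists (star o); rewrite starE star0.
by exists (complete 'I_n); rewrite gen_edge_conn_complete // card_ord.
Qed.
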